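(* Consider the algorithm described in the context, suppose it does not terminate finitely, and suppose there is $\sigma_{\min}>0$ with $\sigma_{\min}(J_k)\ge\sigma_{\min}$ for all $k\in\mathbb{N}$. Let $\epsilon>0$. If $k_1<k_2$ are iterations such that $k\in\mathcal S$ and $\chi_k>\epsilon$ for all $k_1\le k<k_2$, then $$k_2-k_1\le\Big\lfloor\frac{\tau_0\big(f(x_0)-f_{\inf}+r(x_0)\big)+\|c(x_0)\|_2}{\kappa_\Phi\epsilon^2}\Big\rfloor,$$ with $\kappa_\Phi:=\eta\min\{\sigma_u\tau_{\min}\alpha_{\min},\ \tfrac{\sigma_c\sigma_{\min}^2}{2\kappa_c(1+\kappa_{\nabla c}^2)},\ \tfrac{\sigma_c\sigma_{\min}^2\kappa_v\alpha_{\min}}{2\kappa_c}\}$. Moreover, the maximum number of iterations before $\chi_k\le\epsilon$ for some iteration $k$ is $$\Big(\max\Big\{0,\Big\lceil\frac{\log\big(\tau_{\min}/(\alpha_0(\tau_{\min}L_g+L_J))\big)}{\log\xi}\Big\rceil\Big\}+1\Big)\Big\lfloor\frac{\tau_0\big(f(x_0)-f_{\inf}+r(x_0)\big)+\|c(x_0)\|_2}{\kappa_\Phi\epsilon^2}\Big\rfloor.$$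
   Context: Problem: $\min_{x\in\mathbb{R}^n} f(x)+r(x)$ subject to $c(x)=0$, where $f:\mathbb{R}^n\to\mathbb{R}$ and $c:\mathbb{R}^n\to\mathbb{R}^m$ ($m\le n$) are continuously differentiable and $r:\mathbb{R}^n\to\mathbb{R}_{\ge 0}$ is convex. Write $g(x)=\nabla f(x)$, $J(x)=\nabla c(x)^T$, and $f_k=f(x_k)$, $g_k=g(x_k)$, $c_k=c(x_k)$, $J_k=J(x_k)$, $r_k=r(x_k)$. All norms are Euclidean (spectral norm for matrices). Merit function: $\Phi_\tau(x)=\tau(f(x)+r(x))+\|c(x)\|_2$. Algorithm: inputs $x_0$, $\alpha_0>0$, $\tau_{-1}>0$; constants $\kappa_v>0$, $\sigma_c,\epsilon_\tau,\xi,\eta\in(0,1)$, $\sigma_u\in(0,1/2]$, $\bar\sigma_u:=\sigma_u+\tfrac12$. For $k=0,1,\dots$: 1. If $J_k^Tc_k\ne0$, compute $v_k$ with $v_k\in\mathrm{Range}(J_k^T)$, $\|v_k\|_2\le\kappa_v\alpha_k\|J_k^Tc_k\|_2$, $\|c_k+J_kv_k\|_2\le\|c_k+J_kv_k^c\|_2$, where $v_k^c=-\beta_k^cJ_k^Tc_k$ with $\beta_k^c$ minimizing $\tfrac12\|c_k-\beta J_kJ_k^Tc_k\|_2^2$ over $0\le\beta\le\kappa_v\alpha_k$. Otherwise set $v_k=0$, and if $c_k\ne0$ terminate. 2. Let $u_k$ be the unique minimizer of $g_k^Tu+\tfrac1{2\alpha_k}\|u\|_2^2+r(x_k+v_k+u)$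 subject to $J_ku=0$; set $s_k=v_k+u_k$. If $s_k=0$, terminate. By the optimality conditions there exist $g_{r,k}\in\partial r(x_k+s_k)$ and $y_k\in\mathbb{R}^m$ with $g_k+\tfrac1{\alpha_k}u_k+g_{r,k}-J_k^Ty_k=0$; $g_{r,k},y_k$ denote such vectors. 3. Let $D_k:=g_k^Ts_k+\bar\sigma_u\|s_k\|_2^2/\alpha_k+r(x_k+s_k)-r_k$; $\tau_{k,\mathrm{trial}}=\infty$ if $D_k\le0$, else $\tau_{k,\mathrm{trial}}=(1-\sigma_c)(\|c_k\|_2-\|c_k+J_kv_k\|_2)/D_k$. Set $\tau_k=\tau_{k-1}$ if $\tau_{k-1}\le\tau_{k,\mathrm{trial}}$, else $\tau_k=\min\{(1-\epsilon_\tau)\tau_{k-1},\tau_{k,\mathrm{trial}}\}$. 4. With $\Delta q_k(s,\tau):=-\tau(g_k^Ts+\tfrac1{2\alpha_k}\|s\|_2^2+r(x_k+s)-r_k)+\|c_k\|_2-\|c_k+J_ks\|_2$: if $\Phi_{\tau_k}(x_k+s_k)\le\Phi_{\tau_k}(x_k)-\eta\Delta q_k(s_k,\tau_k)$ set $x_{k+1}=x_k+s_k$, $\alpha_{k+1}=\alpha_k$ (iteration $k$ successful; $\mathcal S$ is the set of successful iterations); else $x_{k+1}=x_k$, $\alpha_{k+1}=\xi\alpha_k$. KKT residual: $\chi_k:=\max\{\|g_k+g_{r,k}-J_k^Ty_k\|_2,\ \|c_k\|_2\}$. Standing assumption: there is an open convex set $\mathcal X$ containing all iterates $x_k$ and trial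 points $x_k+s_k$, and positive constants such that for all $x\in\mathcal X$: $f(x)\ge f_{\inf}$, $\|\nabla f(x)\|_2\le\kappa_{\nabla f}$, $\|c(x)\|_2\le\kappa_c$, $\|J(x)\|_2\le\kappa_{\nabla c}$, every $w\in\partial r(x)$ has $\|w\|_2\le\kappa_{\partial r}$; $\nabla f$ is $L_g$-Lipschitz and $J$ is $L_J$-Lipschitz on $\mathcal X$. Constants: with $K:=2\kappa_v\kappa_{\nabla c}(\kappa_{\nabla f}+\kappa_{\partial r}+\bar\sigma_u\kappa_c\kappa_v\kappa_{\nabla c})$, $\tau_{\min,\mathrm{trial}}:=\min\{(1-\sigma_c)\kappa_v\sigma_{\min}^2/K,\ (1-\sigma_c)(\sigma_{\min}/\kappa_{\nabla c})^2/(K\alpha_0)\}$, $\tau_{\min}:=\min\{\tau_0,(1-\epsilon_\tau)\tau_{\min,\mathrm{trial}}\}$, and $\alpha_{\min}:=\min\{\alpha_0,\xi\tau_{\min}/(\tau_{\min}L_g+L_J)\}$. *)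

(* Defs.v *)
From HB Require Import structures.
From mathcomp Require Import all_boot all_order all_algebra.
From mathcomp Require Import all_classical all_reals all_analysis.
Set Implicit Arguments. Unset Strict Implicit. Unset Printing Implicit Defensive.
Import Order.TTheory GRing.Theory Num.Theory.
Import numFieldNormedType.Exports.
Local Open Scope ring_scope.
Local Open Scope classical_set_scope.

Definition dotv {R : realType} {k : nat} (a b : 'cV[R]_k) : R :=
  \sum_(i < k) a i 0 * b i 0.
Definition norm2 {R : realType} {k : nat} (a : 'cV[R]_k) : R :=
  Num.sqrt (dotv a a).

Definition opnorm {R : realType} {p q : nat} (A : 'M[R]_(p, q)) : R :=
  sup [set norm2 (A *m w) | w in [set w : 'cV[R]_q | norm2 w <= 1]].

(* smallest singular value of a p x q matrix with p <= q:
   sigma_min(A) = min_{||y||=1} ||A^T y|| (y in R^p) *)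
Definition sigma_min {R : realType} {p q : nat} (A : 'M[R]_(p, q)) : R :=
  inf [set norm2 (A^T *m w) | w in [set w : 'cV[R]_p | norm2 w = 1]].

Definition convex_fun {R : realType} {n : nat} (h : 'cV[R]_n -> R) : Prop :=
  forall (a b : 'cV[R]_n) (t : R), 0 <= t <= 1 ->
    h (t *: a + (1 - t) *: b) <= t * h a + (1 - t) * h b.

Definition convex_set {R : realType} {n : nat} (X : set 'cV[R]_n) : Prop :=
  forall (a b : 'cV[R]_n) (t : R), X a -> X b -> 0 <= t <= 1 ->
    X (t *: a + (1 - t) *: b).

Definition subgrad {R : realType} {n : nat} (h : 'cV[R]_n -> R)
  (z w : 'cV[R]_n) : Prop :=
  forall z' : 'cV[R]_n, h z + dotv w (z' - z) <= h z'.

Definition Phi {R : realType} {n m : nat} (f r : 'cV[R]_n -> R)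
  (c : 'cV[R]_n -> 'cV[R]_m) (tau : R) (z : 'cV[R]_n) : R :=
  tau * (f z + r z) + norm2 (c z).

Definition Dq {R : realType} {n m : nat} (f r : 'cV[R]_n -> R)
  (g : 'cV[R]_n -> 'cV[R]_n) (c : 'cV[R]_n -> 'cV[R]_m)
  (J : 'cV[R]_n -> 'M[R]_(m, n)) (xk : 'cV[R]_n) (ak : R)
  (s : 'cV[R]_n) (tau : R) : R :=
  - tau * (dotv (g xk) s + (2 * ak)^-1 * norm2 s ^+ 2 + r (xk + s) - r xk)
  + norm2 (c xk) - norm2 (c xk + J xk *m s).

Definition tau_prev {R : realType} (taum1 : R) (tau : nat -> R) (k : nat) : R :=
  match k with 0%N => taum1 | k'.+1 => tau k' end.

Definition successful {R : realType} {n m : nat} (f r : 'cV[R]_n -> R)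
  (g : 'cV[R]_n -> 'cV[R]_n) (c : 'cV[R]_n -> 'cV[R]_m)
  (J : 'cV[R]_n -> 'M[R]_(m, n)) (eta : R)
  (x v u : nat -> 'cV[R]_n) (alpha tau : nat -> R) (k : nat) : Prop :=
  Phi f r c (tau k) (x k + (v k + u k))
    <= Phi f r c (tau k) (x k) - eta * Dq f r g c J (x k) (alpha k) (v k + u k) (tau k).

Definition chi {R : realType} {n m : nat} (g : 'cV[R]_n -> 'cV[R]_n)
  (c : 'cV[R]_n -> 'cV[R]_m) (J : 'cV[R]_n -> 'M[R]_(m, n))
  (x gr : nat -> 'cV[R]_n) (y : nat -> 'cV[R]_m) (k : nat) : R :=
  Num.max (norm2 (g (x k) + gr k - (J (x k))^T *m y k)) (norm2 (c (x k))).

(* The sequences (x_k, alpha_k, tau_k, v_k, u_k, g_{r,k}, y_k) are generated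
   by the algorithm (every iteration k is carried out, i.e. the run does not
   terminate; termination is expressed separately). *)
Definition algorithm_run {R : realType} {n m : nat} (f r : 'cV[R]_n -> R)
  (g : 'cV[R]_n -> 'cV[R]_n) (c : 'cV[R]_n -> 'cV[R]_m)
  (J : 'cV[R]_n -> 'M[R]_(m, n))
  (kv sigc epst xi eta sigu taum1 : R)
  (x v u gr : nat -> 'cV[R]_n) (y : nat -> 'cV[R]_m) (alpha tau : nat -> R)
  : Prop :=
  forall k : nat,
  let xk := x k in let gk := g xk in let ck := c xk in let Jk := J xk in
  let ak := alpha k in let sk := v k + u k in
  ((Jk^T *m ck != 0) ->
     (exists w : 'cV[R]_m, v k = Jk^T *m w)
     /\ norm2 (v k) <= kv * ak * norm2 (Jk^T *m ck)
     /\ (exists beta : R,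
           0 <= beta <= kv * ak
           /\ (forall b : R, 0 <= b <= kv * ak ->
                 2^-1 * norm2 (ck - beta *: (Jk *m (Jk^T *m ck))) ^+ 2
                 <= 2^-1 * norm2 (ck - b *: (Jk *m (Jk^T *m ck))) ^+ 2)
           /\ norm2 (ck + Jk *m v k)
              <= norm2 (ck + Jk *m (- beta *: (Jk^T *m ck)))))
  /\ (Jk^T *m ck = 0 -> v k = 0)
  /\ Jk *m u k = 0
  /\ (forall w : 'cV[R]_n, Jk *m w = 0 ->
        dotv gk (u k) + (2 * ak)^-1 * norm2 (u k) ^+ 2 + r (xk + v k + u k)
        <= dotv gk w + (2 * ak)^-1 * norm2 w ^+ 2 + r (xk + v k + w))
  /\ subgrad r (xk + sk) (gr k)
  /\ gk + ak^-1 *: u k + gr k - Jk^T *m y k = 0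
  /\ (let tp := tau_prev taum1 tau k in
      let D := dotv gk sk + (sigu + 2^-1) * norm2 sk ^+ 2 / ak
               + r (xk + sk) - r xk in
      let trial := (1 - sigc) * (norm2 ck - norm2 (ck + Jk *m v k)) / D in
      tau k = (if D <= 0 then tp
               else if tp <= trial then tp
               else Num.min ((1 - epst) * tp) trial))
  /\ (successful f r g c J eta x v u alpha tau k ->
        x k.+1 = xk + sk /\ alpha k.+1 = ak)
  /\ (~ successful f r g c J eta x v u alpha tau k ->
        x k.+1 = xk /\ alpha k.+1 = xi * ak).

(* Main.v *)
(* The shifted merit value tau_k (f(x_k) - f_inf + r(x_k)) + |c(x_k)| is
   nonnegative and nonincreasing. On a successful iteration it drops by at
   least eta times the model reduction, which exceeds eps^2 times a constant
   when chi_k > eps: the residual equals |u_k| / alpha_k, and the Cauchy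
   decrease bounds |c_k| - |c_k + J_k v_k| below by a multiple of |c_k|.
   This bounds the number of successes; the number w of failures is bounded
   because alpha_k = alpha_0 xi^w and the descent lemma makes every step with
   alpha_k <= tau_min / (tau_min L_g + L_J) successful.

   Adding the two counts stays below (U + 1) F only if F >= 1, where F and U
   are the floor and the ceiling of the statement. When chi_0 > eps, F >= 1
   follows from a lower bound on f(x_0) - f_inf + r(x_0) obtained along the
   segment from x_0 to its (possibly rejected) trial point. *)
Require Import Defs.
From HB Require Import structures.
From mathcomp Require Import all_boot all_order all_algebra.
From mathcomp Require Import all_classical all_reals all_analysis.
From mathcomp Require Import ring lra zify.
Import Order.TTheory GRing.Theory Num.Theory.
Import numFieldNormedType.Exports.
Local Open Scope ring_scope.
Local Open Scope classical_set_scope.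

(** * Euclidean inner product and norm *)

Lemma dotvC {R : realType} {k} (a b : 'cV[R]_k) : dotv a b = dotv b a.
Proof. by apply: eq_bigr => i _; rewrite mulrC. Qed.

Lemma dotvDl {R : realType} {k} (a b d : 'cV[R]_k) :
  dotv (a + b) d = dotv a d + dotv b d.
Proof. by rewrite -big_split; apply: eq_bigr => i _; rewrite mxE mulrDl. Qed.

Lemma dotvZl {R : realType} {k} (t : R) (a b : 'cV[R]_k) :
  dotv (t *: a) b = t * dotv a b.
Proof. by rewrite big_distrr; apply: eq_bigr => i _; rewrite mxE /= mulrA. Qed.

Lemma dotvDr {R : realType} {k} (a b d : 'cV[R]_k) :
  dotv d (a + b) = dotv d a + dotv d b.
Proof. by rewrite !(dotvC d) dotvDl. Qed.

Lemma dotvZr {R : realType} {k} (t : R) (a b : 'cV[R]_k) :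
  dotv a (t *: b) = t * dotv a b.
Proof. by rewrite !(dotvC a) dotvZl. Qed.

Lemma dotvNr {R : realType} {k} (a b : 'cV[R]_k) : dotv a (- b) = - dotv a b.
Proof. by rewrite -scaleN1r dotvZr mulN1r. Qed.

Lemma dotvNl {R : realType} {k} (a b : 'cV[R]_k) : dotv (- a) b = - dotv a b.
Proof. by rewrite dotvC dotvNr dotvC. Qed.

Lemma dotv0 {R : realType} {k} (a : 'cV[R]_k) : dotv a 0 = 0.
Proof. by rewrite -(scale0r 0) dotvZr mul0r. Qed.

Lemma dotv_mulmx {R : realType} {p q} (A : 'M[R]_(p, q)) a b :
  dotv (A *m a) b = dotv a (A^T *m b).
Proof.
rewrite /dotv; under eq_bigr do rewrite mxE big_distrl /=.
rewrite exchange_big; apply: eq_bigr => j _ /=.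
by rewrite mxE big_distrr; apply: eq_bigr => i _ /=; rewrite mxE mulrCA mulrA.
Qed.

Lemma dotvv_ge0 {R : realType} {k} (a : 'cV[R]_k) : 0 <= dotv a a.
Proof. by apply: sumr_ge0 => i _; rewrite -expr2 sqr_ge0. Qed.

Lemma norm2_sqr {R : realType} {k} (a : 'cV[R]_k) : norm2 a ^+ 2 = dotv a a.
Proof. by rewrite sqr_sqrtr ?dotvv_ge0. Qed.

Lemma norm2_ge0 {R : realType} {k} (a : 'cV[R]_k) : 0 <= norm2 a.
Proof. exact: sqrtr_ge0. Qed.

Lemma norm2_eq0 {R : realType} {k} (a : 'cV[R]_k) : norm2 a = 0 -> a = 0.
Proof.
move=> a0; have /eqP : dotv a a = 0 by rewrite -norm2_sqr a0 expr0n.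
rewrite psumr_eq0 => [/allP h|i _]; last by rewrite -expr2 sqr_ge0.
apply/matrixP => i j; rewrite ord1 mxE.
by have := h i (mem_index_enum i); rewrite -expr2 sqrf_eq0 => /eqP.
Qed.

Lemma norm20 {R : realType} {k} : norm2 (0 : 'cV[R]_k) = 0.
Proof. by rewrite /norm2 dotv0 sqrtr0. Qed.

Lemma norm2Z {R : realType} {k} (t : R) (a : 'cV[R]_k) :
  norm2 (t *: a) = `|t| * norm2 a.
Proof.
by rewrite /norm2 dotvZl dotvZr mulrA -expr2 sqrtrM ?sqr_ge0 // sqrtr_sqr.
Qed.

Lemma norm2N {R : realType} {k} (a : 'cV[R]_k) : norm2 (- a) = norm2 a.
Proof. by rewrite -scaleN1r norm2Z normrN1 mul1r. Qed.

Lemma norm2_sqrD {R : realType} {k} (a b : 'cV[R]_k) :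
  norm2 (a + b) ^+ 2 = norm2 a ^+ 2 + 2 * dotv a b + norm2 b ^+ 2.
Proof. rewrite !norm2_sqr dotvDl !dotvDr (dotvC b a); lra. Qed.

(** Cauchy-Schwarz: expand the nonnegative squared norm of [norm2 b *: a - norm2 a *: b] and divide
    by [norm2 a * norm2 b]. *)
Lemma dotv_le_norm2 {R : realType} {k} (a b : 'cV[R]_k) :
  dotv a b <= norm2 a * norm2 b.
Proof.
have a0 := norm2_ge0 a; have b0 := norm2_ge0 b.
have [/norm2_eq0 ->|an0] := eqVneq (norm2 a) 0.
  by rewrite dotvC dotv0 norm20 mul0r.
have [/norm2_eq0 ->|bn0] := eqVneq (norm2 b) 0; first by rewrite dotv0 norm20 mulr0.
have := sqr_ge0 (norm2 (norm2 b *: a + - (norm2 a *: b))).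
rewrite norm2_sqrD norm2N dotvNr dotvZl dotvZr !norm2Z !ger0_norm // => h.
have ab0 : 0 < norm2 a * norm2 b by rewrite mulr_gt0 ?lt0r ?an0 ?bn0.
rewrite -(ler_pM2l ab0); lra.
Qed.

Lemma norm2D {R : realType} {k} (a b : 'cV[R]_k) : norm2 (a + b) <= norm2 a + norm2 b.
Proof.
rewrite -ler_sqr ?nnegrE ?addr_ge0 ?norm2_ge0 // norm2_sqrD.
have := dotv_le_norm2 a b; lra.
Qed.

(** * Operator norm and smallest singular value *)

(** The Frobenius norm serves as [C]. Some finite bound has to be known before the [sup] in [opnorm]
    can be used as an upper bound. *)
Lemma norm2_mulmx_bounded {R : realType} {p q} (A : 'M[R]_(p, q)) :
  exists2 C : R, 0 <= C & forall w, norm2 (A *m w) <= C * norm2 w.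
Proof.
pose F := \sum_i norm2 (row i A)^T ^+ 2.
have F0 : 0 <= F by apply: sumr_ge0 => i _; exact: sqr_ge0.
exists (Num.sqrt F); first exact: sqrtr_ge0.
move=> w; rewrite -ler_sqr ?nnegrE ?mulr_ge0 ?sqrtr_ge0 ?norm2_ge0 //.
rewrite exprMn (sqr_sqrtr F0) norm2_sqr big_distrl /=; apply: ler_sum => i _.
have -> : (A *m w) i 0 = dotv (row i A)^T w.
  by rewrite mxE; apply: eq_bigr => j _; rewrite !mxE.
rewrite -expr2 -exprMn -ler_sqrt ?sqr_ge0 // !sqrtr_sqr.
rewrite (ger0_norm (mulr_ge0 _ _)) ?norm2_ge0 // ler_norml dotv_le_norm2 andbT.
by rewrite lerNl -dotvNl (le_trans (dotv_le_norm2 _ _)) // norm2N.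
Qed.

Lemma norm2_mulmx_le {R : realType} {p q} (A : 'M[R]_(p, q)) w :
  norm2 (A *m w) <= opnorm A * norm2 w.
Proof.
have [w0|wn0] := eqVneq (norm2 w) 0.
  by rewrite (norm2_eq0 w w0) mulmx0 !norm20 mulr0.
have w0 : 0 < norm2 w by rewrite lt0r wn0 norm2_ge0.
rewrite -ler_pdivrMr //.
have [C C0 AC] := norm2_mulmx_bounded A.
apply: ub_le_sup.
  exists C => _ [z /= z1 <-]; apply: le_trans (AC z) _.
  by rewrite -[leRHS]mulr1 ler_wpM2l.
exists ((norm2 w)^-1 *: w) => /=.
  by rewrite norm2Z ger0_norm ?invr_ge0 ?norm2_ge0 // mulVf.
by rewrite -scalemxAr norm2Z ger0_norm ?invr_ge0 ?norm2_ge0 // mulrC.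
Qed.

Lemma opnorm_le_norm2 {R : realType} {p q} (A : 'M[R]_(p, q)) L w :
  opnorm A <= L -> norm2 (A *m w) <= L * norm2 w.
Proof. by move=> AL; rewrite (le_trans (norm2_mulmx_le _ _)) ?ler_wpM2r ?norm2_ge0. Qed.

(** The square of [norm2 (A^T *m w)] is the inner product of [A *m (A^T *m w)] with [w], hence at
    most [L * norm2 (A^T *m w) * norm2 w]; one factor cancels. *)
Lemma norm2_trmx_mulmx_le {R : realType} {p q} (A : 'M[R]_(p, q)) L w :
  0 <= L -> opnorm A <= L -> norm2 (A^T *m w) <= L * norm2 w.
Proof.
move=> L0 AL; have := norm2_sqr (A^T *m w); rewrite -dotv_mulmx.
have h1 := dotv_le_norm2 (A *m (A^T *m w)) w.
have h2 := opnorm_le_norm2 _ _ (A^T *m w) AL.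
have n0 := norm2_ge0 w; have t0 := norm2_ge0 (A^T *m w) => e.
have [->|tn0] := eqVneq (norm2 (A^T *m w)) 0; first by rewrite mulr_ge0.
have tp : 0 < norm2 (A^T *m w) by rewrite lt0r tn0.
rewrite -(ler_pM2l tp) -expr2 e; apply: le_trans h1 _.
by rewrite mulrA (mulrC _ L) ler_wpM2r.
Qed.

(** Normalizing [w] puts it in the set defining [sigma_min], which is bounded below by 0. *)
Lemma sigma_min_le_norm2 {R : realType} {p q} (A : 'M[R]_(p, q)) s w :
  s <= sigma_min A -> s * norm2 w <= norm2 (A^T *m w).
Proof.
move=> sA.
have [w0|wn0] := eqVneq (norm2 w) 0.
  by rewrite (norm2_eq0 w w0) mulmx0 !norm20 mulr0.
have w0 : 0 < norm2 w by rewrite lt0r wn0 norm2_ge0.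
rewrite -ler_pdivlMr //; apply: le_trans sA _; apply: ge_inf.
  by exists 0 => _ [z _ <-]; exact: norm2_ge0.
exists ((norm2 w)^-1 *: w) => /=.
  by rewrite norm2Z ger0_norm ?invr_ge0 ?norm2_ge0 // mulVf.
by rewrite -scalemxAr norm2Z ger0_norm ?invr_ge0 ?norm2_ge0 // mulrC.
Qed.

(** * First-order expansions along a segment *)

(** Mean value theorem for [phi] minus the quadratic [dphi 0 * t + M / 2 * t ^+ 2], a difference
    whose derivative is nonpositive on the unit interval. *)
Lemma le_taylor1 {R : realType} (phi dphi : R -> R) (M : R) :
  (forall t : R, is_derive t 1 phi (dphi t)) ->
  (forall t, 0 <= t <= 1 -> dphi t <= dphi 0 + M * t) ->
  phi 1 <= phi 0 + dphi 0 + M / 2.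
Proof.
move=> dphiP dphi_le.
pose h t := phi t - (dphi 0 * t + M / 2 * t ^+ 2).
have dh (t : R) : is_derive t 1 h (dphi t - (dphi 0 + M * t)).
  have := dphiP t => ?.
  by apply: is_derive_eq; rewrite !scalerDr -![_ *: _]/(_ * _); lra.
have [|t t01 e] := MVT ltr01 (fun t _ => dh t).
  apply: derivable_within_continuous => t _; exact: ex_derive.
move: t01; rewrite in_itv => /andP[t0 t1].
have := dphi_le t; rewrite (ltW t0) (ltW t1) => /(_ isT).
move: e; rewrite /h; lra.
Qed.

Lemma is_derive_line {R : realType} {n : nat} {W : normedModType R}
  (f : 'cV[R]_n -> W) z s (t : R) :
  differentiable f (z + t *: s) ->
  is_derive t 1 (fun t => f (z + t *: s)) ('d f (z + t *: s) s).
Proof.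
move=> df.
have dl : is_diff t (fun t : R => z + t *: s) (fun t => t *: s).
  have -> : (fun t : R => t *: s) = 0 + ( *:%R^~ s) :> (R -> 'cV[R]_n).
    by apply: funext => ?; rewrite /= add0r.
  exact: is_diffD.
have dc : is_diff t (f \o (fun t => z + t *: s)) ('d f (z + t *: s) \o (fun t => t *: s)).
  apply: is_diff_comp; exact: differentiableP.
apply: DeriveDef; first by apply: diff_derivable.
by rewrite deriveE // diff_val /= scale1r.
Qed.

(** The Lipschitz bound is asked only along the segment, so that a convex set containing both
    endpoints can supply it. The scalar estimate is used with [M = L * norm2 s ^+ 2]. *)
Lemma descent_lemma {R : realType} {n : nat} (f : 'cV[R]_n -> R) (g : 'cV[R]_n -> 'cV[R]_n) (z s : 'cV[R]_n) (L : R) :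
  (forall z, differentiable f z /\ forall h, 'd f z h = dotv (g z) h) ->
  (forall t, 0 <= t <= 1 -> norm2 (g (z + t *: s) - g z) <= L * norm2 (t *: s)) ->
  f (z + s) <= f z + dotv (g z) s + L / 2 * norm2 s ^+ 2.
Proof.
move=> df gL.
have dphi (t : R) :
    is_derive t 1 (fun t => f (z + t *: s)) (dotv (g (z + t *: s)) s).
  by have [d <-] := df (z + t *: s); exact: is_derive_line.
have := le_taylor1 _ _ (L * norm2 s ^+ 2) dphi.
rewrite scale1r scale0r addr0 (mulrAC L); apply => t t01.
rewrite -lerBlDl -dotvNl -dotvDl.
apply: le_trans (dotv_le_norm2 _ _) _.
have := gL t t01; rewrite norm2Z ger0_norm; last by case/andP: t01.
move=> /(ler_wpM2r (norm2_ge0 s)); lra.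
Qed.

Lemma norm2_linearization_le {R : realType} {n m : nat}
  (c : 'cV[R]_n -> 'cV[R]_m) (J : 'cV[R]_n -> 'M[R]_(m, n)) (z s : 'cV[R]_n) (L : R) :
  0 <= L ->
  (forall z, differentiable c z /\ forall h, 'd c z h = J z *m h) ->
  (forall t, 0 <= t <= 1 -> opnorm (J (z + t *: s) - J z) <= L * norm2 (t *: s)) ->
  norm2 (c (z + s)) <= norm2 (c z + J z *m s) + L / 2 * norm2 s ^+ 2.
Proof.
move=> L0 dc JL.
(* the remainder [e] is bounded by applying the scalar estimate to [<e, c>] *)
set e := c (z + s) - (c z + J z *m s).
have dphi (t : R) :
    is_derive t 1 (fun t : R => dotv e (c (z + t *: s))) (dotv e (J (z + t *: s) *m s)).
  have [d dE] := dc (z + t *: s).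
  have dt : is_derive t 1 (fun t : R => c (z + t *: s)) (J (z + t *: s) *m s).
    by rewrite -dE; exact: is_derive_line.
  (* The inner product with [e] is a finite sum over coordinates, so the derivative is needed
     coordinatewise. *)
  have di i : is_derive t 1 (fun t : R => c (z + t *: s) i 0) ((J (z + t *: s) *m s) i 0).
    have /derivable_mxP dm : derivable (fun t : R => c (z + t *: s)) t 1 by exact: ex_derive.
    apply: DeriveDef; first exact: dm.
    have -> : J (z + t *: s) *m s = 'D_1 (fun t : R => c (z + t *: s)) t.
      by rewrite derive_val.
    by rewrite derive_mx ?mxE //; apply/derivable_mxP.
  have -> : (fun t : R => dotv e (c (z + t *: s))) =
      \sum_(i < m) (fun t : R => e i 0 * c (z + t *: s) i 0).
    by apply: funext => t'; rewrite fct_sumE.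
  apply: is_derive_sum => i; exact: is_deriveZ.
have := le_taylor1 _ _ (norm2 e * L * norm2 s ^+ 2) dphi.
rewrite scale1r scale0r addr0 => h.
have {h} eL : norm2 e <= L / 2 * norm2 s ^+ 2.
  have [->|en0] := eqVneq (norm2 e) 0.
    by rewrite mulr_ge0 ?divr_ge0 ?sqr_ge0.
  have ep : 0 < norm2 e by rewrite lt0r en0 norm2_ge0.
  (* The scalar remainder is [norm2 e ^+ 2] itself, so the estimate bounds it by
     [norm2 e * L / 2 * norm2 s ^+ 2] and a factor [norm2 e] cancels. *)
  rewrite -(ler_pM2l ep) -expr2.
  have -> : norm2 e ^+ 2 = dotv e (c (z + s)) - (dotv e (c z) + dotv e (J z *m s)).
    by rewrite norm2_sqr -dotvDr -dotvNr -dotvDr.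
  suff /h : forall t, 0 <= t <= 1 -> dotv e (J (z + t *: s) *m s) <=
     dotv e (J z *m s) + norm2 e * L * norm2 s ^+ 2 * t by lra.
  move=> t t01; rewrite -lerBlDl -dotvNr -dotvDr -mulmxBl.
  apply: le_trans (dotv_le_norm2 _ _) _.
  have := opnorm_le_norm2 _ _ s (JL t t01).
  rewrite norm2Z ger0_norm; last by case/andP: t01.
  move=> /(ler_wpM2l (norm2_ge0 e)); lra.
have -> : c (z + s) = (c z + J z *m s) + e by rewrite [RHS]addrC subrK.
by apply: le_trans (norm2D _ _) _; rewrite lerD2l.
Qed.

(** * Decrease of the linearized constraint violation and of the model *)

(** The step [v] does at least as well as the Cauchy step, whose length is optimal on [[0, b]],
    hence at least as well as the length [b1 = min(b, kgc^-2)]. Since [b1 * kgc ^+ 2 <= 1], the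
    second-order term at [b1] costs at most half of the first-order gain, and [sigmin] converts
    [J^T *m c] back into [c]. *)
Lemma cauchy_decrease {R : realType} {n m : nat} (J : 'M[R]_(m, n))
  (c : 'cV[R]_m) (v : 'cV[R]_n) (b kgc sigmin : R) :
  0 < b -> 0 < kgc -> 0 < sigmin ->
  opnorm J <= kgc -> sigmin <= sigma_min J ->
  (J^T *m c = 0 -> v = 0) ->
  (J^T *m c != 0 -> exists beta : R,
     (forall b', 0 <= b' <= b ->
        2^-1 * norm2 (c - beta *: (J *m (J^T *m c))) ^+ 2
        <= 2^-1 * norm2 (c - b' *: (J *m (J^T *m c))) ^+ 2)
     /\ norm2 (c + J *m v) <= norm2 (c + J *m (- beta *: (J^T *m c)))) ->
  2^-1 * Num.min b (kgc ^- 2) * sigmin ^+ 2 * norm2 c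
    <= norm2 c - norm2 (c + J *m v).
Proof.
move=> b0 kgc0 sig0 JL sJ v0 vP.
have sd := sigma_min_le_norm2 _ sigmin c sJ.
have p0 := norm2_ge0 c.
have [d0|dn0] := eqVneq (J^T *m c) 0.
  rewrite d0 norm20 in sd.
  have c0 : norm2 c = 0 by apply/eqP; rewrite eq_le p0 andbT -(ler_pM2l sig0) mulr0.
  by rewrite v0 // mulmx0 addr0 c0 mulr0 subrr.
have [beta [bmin vle]] := vP dn0.
set b1 := Num.min b _.
have b1_gt0 : 0 < b1 by rewrite lt_min b0 invr_gt0 exprn_gt0.
have b1b : b1 <= b by rewrite ge_min lexx.
have b1k : b1 * kgc ^+ 2 <= 1.
  by rewrite -ler_pdivlMr ?exprn_gt0 // div1r ge_min lexx orbT.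
set q := norm2 (c + J *m v) in vle *.
have q0 : 0 <= q := norm2_ge0 _.
have q2 : q ^+ 2 <= norm2 c ^+ 2 - b1 * norm2 (J^T *m c) ^+ 2.
  apply: (@le_trans _ _ (norm2 (c - b1 *: (J *m (J^T *m c))) ^+ 2)).
    rewrite -(ler_pM2l (_ : 0 < 2^-1 :> R)) ?invr_gt0 //.
    apply: le_trans (bmin _ _); last by rewrite ltW.
    rewrite ler_pM2l ?invr_gt0 // ler_sqr ?nnegrE ?norm2_ge0 //.
    by rewrite -scalemxAr scaleNr in vle.
  rewrite norm2_sqrD norm2N norm2Z gtr0_norm // dotvNr dotvZr.
  have -> : dotv c (J *m (J^T *m c)) = norm2 (J^T *m c) ^+ 2.
    by rewrite dotvC dotv_mulmx norm2_sqr.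
  have := opnorm_le_norm2 _ _ (J^T *m c) JL.
  rewrite -ler_sqr ?nnegrE ?mulr_ge0 ?norm2_ge0 ?(ltW kgc0) //.
  rewrite !exprMn => /(ler_wpM2l (sqr_ge0 b1)).
  have := ler_wpM2r (mulr_ge0 (ltW b1_gt0) (sqr_ge0 (norm2 (J^T *m c)))) b1k.
  lra.
have pp : 0 < norm2 c.
  rewrite lt0r p0 andbT; apply: contra_neq dn0 => /norm2_eq0 ->.
  by rewrite mulmx0.
have d2 : sigmin ^+ 2 * norm2 c ^+ 2 <= norm2 (J^T *m c) ^+ 2.
  by rewrite -exprMn ler_sqr ?nnegrE ?mulr_ge0 ?norm2_ge0 ?(ltW sig0).
have {d2} := ler_wpM2l (ltW b1_gt0) d2.
have qp : q <= norm2 c.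
  rewrite -ler_sqr ?nnegrE //; apply: le_trans q2 _.
  by rewrite gerBl mulr_ge0 ?sqr_ge0 // ltW.
move=> d2; rewrite -(ler_pM2l pp).
(* The factor 1/2 of the conclusion arises here: [|c| (|c| - q) = (|c|^2 - q^2) / 2 + (|c| - q)^2 /
   2]. *)
have := mulr_ge0 (_ : 0 <= norm2 c - q) (_ : 0 <= norm2 c - q).
rewrite subr_ge0 => /(_ qp qp); lra.
Qed.

Lemma norm2_sqrD_orth {R : realType} {n m : nat} (J : 'M[R]_(m, n))
  (u v : 'cV[R]_n) :
  J *m u = 0 -> (exists w, v = J^T *m w) ->
  norm2 (v + u) ^+ 2 = norm2 v ^+ 2 + norm2 u ^+ 2.
Proof.
move=> Ju [w ->]; rewrite norm2_sqrD dotvC -dotv_mulmx Ju dotvC dotv0; lra.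
Qed.

(** The subgradient inequality replaces the change of [r] by the inner product of [gr] with [v + u].
    Stationarity tested against [u] removes the multiplier [y] and yields [- norm2 u ^+ 2 / a]. What
    is left involves only [v], whose norm is at most [kv * a * kgc * norm2 c]. *)
Lemma model_decrease {R : realType} {n m : nat} (r : 'cV[R]_n -> R)
  (J : 'M[R]_(m, n)) (z u v g gr : 'cV[R]_n) (y c : 'cV[R]_m)
  (a kv kgf kdr kc kgc sigbar : R) :
  0 < a -> 0 < kv -> 0 < kgc -> 0 <= sigbar ->
  J *m u = 0 -> (exists w, v = J^T *m w) ->
  norm2 v <= kv * a * norm2 (J^T *m c) ->
  subgrad r (z + (v + u)) gr -> g + a^-1 *: u + gr - J^T *m y = 0 ->
  norm2 g <= kgf -> norm2 gr <= kdr -> norm2 c <= kc -> opnorm J <= kgc ->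
  dotv g (v + u) + r (z + (v + u)) - r z + norm2 u ^+ 2 / a + sigbar * norm2 v ^+ 2 / a
   <= kv * kgc * (kgf + kdr + sigbar * kc * kv * kgc) * a * norm2 c.
Proof.
move=> a0 kv0 kgc0 sb0 Ju [w vE] vle rP opt gle grle cle JL.
have uv : dotv u v = 0 by rewrite vE -dotv_mulmx Ju dotvC dotv0.
have uJy : dotv (J^T *m y) u = 0 by rewrite dotvC -dotv_mulmx Ju dotvC dotv0.
have := rP z; rewrite opprD addNKr dotvNr => rz.
have rEg : gr = J^T *m y - g - a^-1 *: u.
  move/eqP: opt; rewrite subr_eq0 => /eqP <-.
  by rewrite (addrC _ gr) -[RHS]addrA -opprD addrK.
have gu : dotv g u + dotv gr u = - (norm2 u ^+ 2 / a).
  by rewrite rEg !dotvDl !dotvNl uJy dotvZl norm2_sqr; lra.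
have v0 := norm2_ge0 v.
have gv : dotv g v <= kgf * norm2 v.
  by apply: le_trans (dotv_le_norm2 _ _) _; rewrite ler_wpM2r.
have grv : dotv gr v <= kdr * norm2 v.
  by apply: le_trans (dotv_le_norm2 _ _) _; rewrite ler_wpM2r.
have vc : norm2 v <= kv * a * (kgc * norm2 c).
  apply: le_trans vle _; rewrite ler_wpM2l ?mulr_ge0 ?(ltW kv0) ?(ltW a0) //.
  by rewrite norm2_trmx_mulmx_le // ltW.
have v2 : norm2 v / a <= kv * kgc * kc.
  rewrite ler_pdivrMr //; apply: le_trans vc _.
  have := ler_wpM2l (mulr_ge0 (mulr_ge0 (ltW kv0) (ltW a0)) (ltW kgc0)) cle; lra.
have v3 := ler_wpM2l sb0 (ler_wpM2l v0 v2).
have kg0 : 0 <= kgf + kdr + sigbar * kc * kv * kgc.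
  have := le_trans (norm2_ge0 _) gle; have := le_trans (norm2_ge0 _) grle.
  have kc0 := le_trans (norm2_ge0 _) cle.
  have : 0 <= sigbar * kc * kv * kgc by rewrite !mulr_ge0 // ltW.
  lra.
have := ler_wpM2l kg0 vc.
rewrite !dotvDr in rz *; lra.
Qed.

(* Here [convex_set] is MathComp-Analysis's, which shadows the one of Defs. *)
Lemma convex_setP {R : realType} {n : nat} (X : set 'cV[R]_n) :
  convex_set X -> Defs.convex_set X.
Proof.
move=> cX a b t Xa Xb /andP[t0 t1].
have := cX a b (Itv01 t0 t1) (mem_set Xa) (mem_set Xb).
by rewrite inE.
Qed.

(** * Merit function, merit parameter and the decrease constant *)

(** Sum of [tau] times the descent lemma for [f] and the linearization bound for [c]. The proximal
    term inside [Dq] contributes [- tau / a], so the error is nonpositive once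
    [a <= tau / (tau * Lg + LJ)]. *)
Lemma merit_descent {R : realType} {n m : nat} (f r : 'cV[R]_n -> R)
  (g : 'cV[R]_n -> 'cV[R]_n) (c : 'cV[R]_n -> 'cV[R]_m)
  (J : 'cV[R]_n -> 'M[R]_(m, n)) (X : set 'cV[R]_n) (Lg LJ a tau : R)
  (z s : 'cV[R]_n) :
  (forall z, differentiable f z /\ forall h, 'd f z h = dotv (g z) h) ->
  (forall z, differentiable c z /\ forall h, 'd c z h = J z *m h) ->
  Defs.convex_set X -> X z -> X (z + s) -> 0 <= LJ ->
  (forall z1 z2, X z1 -> X z2 ->
     norm2 (g z1 - g z2) <= Lg * norm2 (z1 - z2)
     /\ opnorm (J z1 - J z2) <= LJ * norm2 (z1 - z2)) ->
  0 < a -> 0 <= tau ->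
  Phi f r c tau (z + s) <= Phi f r c tau z - Dq f r g c J z a s tau
    + ((tau * Lg + LJ) - tau / a) * norm2 s ^+ 2 / 2.
Proof.
move=> df dc Xc Xz Xzs LJ0 lip a0 tau0.
have seg t : 0 <= t <= 1 -> X (z + t *: s).
  move=> t01; have := Xc _ _ t Xzs Xz t01.
  by rewrite scalerDr scalerBl scale1r addrC addrA subrK.
have sub t : z + t *: s - z = t *: s by rewrite addrC addKr.
have fs : f (z + s) <= f z + dotv (g z) s + Lg / 2 * norm2 s ^+ 2.
  by apply: descent_lemma => // t t01; rewrite -[in leRHS](sub t); exact: (lip _ _ (seg t t01) Xz).1.
have cs : norm2 (c (z + s)) <= norm2 (c z + J z *m s) + LJ / 2 * norm2 s ^+ 2.
  by apply: norm2_linearization_le => // t t01; rewrite -[in leRHS](sub t); exact: (lip _ _ (seg t t01) Xz).2.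
have := ler_wpM2l tau0 fs.
rewrite /Phi /Dq invfM; lra.
Qed.

(** The two entries of the minimum on the left match the two branches of the Cauchy step length on
    the right; the second branch uses [a <= a0]. *)
Lemma tau_min_trial_le {R : realType} (sigc kv s K kgc a a0 : R) :
  sigc < 1 -> 0 < kv -> 0 < K -> 0 < kgc -> 0 < a <= a0 ->
  Num.min ((1 - sigc) * kv * s ^+ 2 / K) ((1 - sigc) * (s / kgc) ^+ 2 / (K * a0))
    * (K * a) <= (1 - sigc) * (Num.min (kv * a) (kgc ^- 2) * s ^+ 2).
Proof.
move=> sc kv0 K0 kg0 /andP[a_gt0 aa0].
have Ka0 : 0 <= K * a by rewrite mulr_ge0 ?ltW.
have a00 := lt_le_trans a_gt0 aa0.
case: (leP (kv * a) (kgc ^- 2)) => _.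
  apply: le_trans (_ : ((1 - sigc) * kv * s ^+ 2 / K) * (K * a) <= _).
    by rewrite ler_wpM2r // ge_min lexx.
  rewrite mulrA divfK ?gt_eqF //; lra.
apply: le_trans (_ : ((1 - sigc) * (s / kgc) ^+ 2 / (K * a0)) * (K * a) <= _).
  by rewrite ler_wpM2r // ge_min lexx orbT.
have -> x : x / (K * a0) * (K * a) = x * (a / a0).
  by field; rewrite !gt_eqF.
rewrite -mulrA ler_wpM2l ?subr_ge0 ?(ltW sc) // expr_div_n (mulrC (kgc ^- 2)).
rewrite ler_piMr //; first by rewrite divr_ge0 // sqr_ge0.
by rewrite ler_pdivrMr // mul1r.
Qed.

(** For [D > 0] the trial value is at least [tmt], so an actual decrease of the merit parameter
    cannot go below [(1 - epst) * tmt]. The bound on [t * D] later leaves a fraction [sigc] of [red]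
    in the model reduction. *)
Lemma tau_update_bounds {R : realType} (tp D red epst sigc tmt t : R) :
  0 < tp -> 0 < epst < 1 -> sigc < 1 -> 0 <= red -> 0 < tmt ->
  (0 < D -> tmt * D <= (1 - sigc) * red) ->
  t = (if D <= 0 then tp
       else if tp <= (1 - sigc) * red / D then tp
       else Num.min ((1 - epst) * tp) ((1 - sigc) * red / D)) ->
  [/\ 0 < t, t <= tp, t * D <= (1 - sigc) * red &
      Num.min tp ((1 - epst) * tmt) <= t].
Proof.
move=> tp0 /andP[e0 e1] sc red0 tmt0 tD ->.
have [D0|D0] := leP D 0.
  split=> //; last by rewrite ge_min lexx.
  by apply: (@le_trans _ _ 0); [rewrite pmulr_rle0|rewrite mulr_ge0 // subr_ge0 ltW].
have {tD} := tD D0; rewrite -ler_pdivlMr // => tt.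
have [h|h] := leP tp.
  by split=> //; [rewrite -ler_pdivlMr|rewrite ge_min lexx].
have ep : 0 < 1 - epst by rewrite subr_gt0.
split.
- by rewrite lt_min mulr_gt0 //= (lt_le_trans tmt0).
- by rewrite ge_min (ltW h) orbT.
- by rewrite -ler_pdivlMr // ge_min lexx orbT.
- rewrite ge_min !le_min; apply/orP; right; apply/andP; split.
    by rewrite ler_pM2l // (le_trans tt) // ltW.
  by apply: le_trans tt; rewrite -[leRHS]mul1r ler_wpM2r ?(ltW tmt0) // gerBl ltW.
Qed.

(** Here [w] and [p] stand for the two parts of the KKT residual. If [w] exceeds [eps], the first
    entry of the minimum suffices; if [p] does, the branch taken by the Cauchy step length selects
    one of the other two. *)
Lemma kPhi_le {R : realType}
  (sigu sigc tmin amin s kc kgc kv t a w p red eps : R) :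
  0 < sigu -> 0 < sigc -> 0 < tmin -> 0 < amin -> 0 < kc -> 0 < kgc -> 0 < kv ->
  tmin <= t -> amin <= a -> 0 <= w -> 0 <= p <= kc -> 0 < eps ->
  2^-1 * Num.min (kv * a) (kgc ^- 2) * s ^+ 2 * p <= red ->
  eps < Num.max w p ->
  Num.min (sigu * tmin * amin)
     (Num.min (sigc * s ^+ 2 / (2 * kc * (1 + kgc ^+ 2)))
              (sigc * s ^+ 2 * kv * amin / (2 * kc))) * eps ^+ 2
  <= t * sigu * (a * w ^+ 2) + sigc * red.
Proof.
have := sqr_ge0 s; move: (s ^+ 2) => s2 s20.
move=> su0 sc0 tm0 am0 kc0 kg0 kv0 tt aa w0 /andP[p0 pk] eps0 redP.
have t0 := lt_le_trans tm0 tt; have a0 := lt_le_trans am0 aa.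
set M := Num.min (kv * a) _ in redP.
have M0 : 0 <= M by rewrite le_min invr_ge0 sqr_ge0 mulr_ge0 // ltW.
have red0 : 0 <= red.
  by apply: le_trans redP; rewrite !mulr_ge0 ?sqr_ge0 ?invr_ge0.
have w20 : 0 <= t * sigu * (a * w ^+ 2) by rewrite !mulr_ge0 // ltW.
set k := Num.min (sigu * tmin * amin) _.
rewrite lt_max => /orP[ew|ep].
  have e2 : eps ^+ 2 <= w ^+ 2 by rewrite ler_sqr ?nnegrE // ltW.
  have k1 : k <= sigu * tmin * amin by rewrite ge_min lexx.
  apply: (@le_trans _ _ (sigu * tmin * amin * w ^+ 2)).
    apply: le_trans (_ : sigu * tmin * amin * eps ^+ 2 <= _).
      by rewrite ler_wpM2r ?sqr_ge0.
    by rewrite ler_wpM2l // !mulr_ge0 ?ltW.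
  rewrite -[leLHS]addr0 lerD ?mulr_ge0 ?(ltW sc0) //.
  rewrite mulrA ler_wpM2r ?sqr_ge0 // (mulrC t) -!mulrA ler_wpM2l ?(ltW su0) //.
  by rewrite ler_pM // ltW.
have e2 : eps ^+ 2 <= p ^+ 2 by rewrite ler_sqr ?nnegrE // ltW.
have kM : k <= sigc * s2 / (2 * kc) * M.
  have c0 : 0 <= sigc * s2 / (2 * kc).
    by rewrite mulr_ge0 ?mulr_ge0 ?sqr_ge0 ?invr_ge0 ?mulr_ge0 // ltW.
  rewrite /M; case: (leP (kv * a) (kgc ^- 2)) => _.
    apply: le_trans (_ : sigc * s2 * kv * amin / (2 * kc) <= _).
      by rewrite !ge_min lexx !orbT.
    have := ler_wpM2l c0 (ler_wpM2l (ltW kv0) aa); lra.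
  apply: le_trans (_ : sigc * s2 / (2 * kc * (1 + kgc ^+ 2)) <= _).
    by rewrite !ge_min lexx !orbT.
  have kg2 : 0 < kgc ^+ 2 by rewrite exprn_gt0.
  rewrite invfM mulrA ler_wpM2l // lef_pV2 ?posrE //; first lra.
  by rewrite addr_gt0.
(* The Cauchy decrease is only linear in [p]; the bound [p <= kc] makes it quadratic and puts [kc]
   in the denominators. *)
have pkc : p ^+ 2 / kc <= p by rewrite ler_pdivrMr // expr2 ler_wpM2l.
have redP2 := ler_wpM2l (ltW sc0) redP.
have h1 : k * eps ^+ 2 <= sigc * s2 / (2 * kc) * M * p ^+ 2.
  apply: ler_pM => //; last exact: sqr_ge0.
  rewrite !le_min; apply/and3P; split.
  - by rewrite !mulr_ge0 // ltW.
  - rewrite mulr_ge0 ?mulr_ge0 ?sqr_ge0 ?invr_ge0 ?(ltW sc0) //.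
    by rewrite !mulr_ge0 ?addr_ge0 ?sqr_ge0 // ltW.
  - rewrite mulr_ge0 ?mulr_ge0 ?sqr_ge0 ?invr_ge0 ?(ltW sc0) ?(ltW kv0) ?(ltW am0) //.
    by rewrite !mulr_ge0 // ltW.
apply: le_trans h1 _.
have c1 : 0 <= sigc * s2 * M * 2^-1.
  by rewrite !mulr_ge0 ?sqr_ge0 ?invr_ge0 // ltW.
have := ler_wpM2l c1 pkc; rewrite invfM; lra.
Qed.

(** * Counting successful and unsuccessful iterations *)

(** The counting is separated from the optimization: [Psi] is a potential losing [kap] at each
    success with a large residual, and [thr] is a threshold below which [alpha] admits no
    failure. *)
Lemma iteration_count {R : realType} (Psi alpha chi : nat -> R) (S : nat -> Prop)
  (xi thr kap eps : R) :
  0 < xi < 1 -> 0 < thr -> 0 < kap ->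
  0 < alpha 0 ->
  (forall k, 0 <= Psi k) -> (forall k, Psi k.+1 <= Psi k) ->
  (forall k, S k -> eps < chi k -> Psi k.+1 + kap <= Psi k) ->
  (forall k, S k -> alpha k.+1 = alpha k) ->
  (forall k, ~ S k -> alpha k.+1 = xi * alpha k /\ thr < alpha k) ->
  (eps < chi 0 -> kap <= Psi 0) ->
  (forall k1 k2, (k1 < k2)%N ->
     (forall k, (k1 <= k < k2)%N -> S k /\ eps < chi k) ->
     (((k2 - k1)%N)%:Z <= Num.floor (Psi 0 / kap))%R)
  /\ exists k : nat,
       (k%:Z <= (Num.max 0 (Num.ceil (ln (thr / alpha 0) / ln xi)) + 1)
                * Num.floor (Psi 0 / kap))%R
       /\ chi k <= eps.
Proof.
move=> /andP[xi0 xi1] thr0 kap0 a0 Psi0 Psid Psik aS aN chi0.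
have floorP (j : nat) k : Psi k + j%:R * kap <= Psi 0 -> (j%:Z <= Num.floor (Psi 0 / kap))%R.
  move=> h; rewrite floor_ge_int_tmp ler_pdivlMr //.
  by apply: le_trans h; rewrite lerDr.
split.
  move=> k1 k2 k12 Sk; apply: (floorP _ k2).
  have Psi1 : Psi k1 <= Psi 0.
    by elim: k1 {k12 Sk} => [//|k IH]; exact: le_trans (Psid _) IH.
  apply: le_trans Psi1.
  move: Sk; rewrite -{1 2}(subnKC (ltnW k12)); move: (k2 - k1)%N => j.
  elim: j => [|j IH] Sk; first by rewrite addn0 mul0r addr0.
  have [Sj chij] : S (k1 + j)%N /\ eps < chi (k1 + j)%N by apply: Sk; lia.
  have := Psik _ Sj chij; rewrite -addnS.
  have {}IH : Psi (k1 + j)%N + j%:R * kap <= Psi k1 by apply: IH => k kj; apply: Sk; lia.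
  by rewrite -natr1; lra.
set U := Num.max 0 _.
have U0 : (0 <= U)%R by rewrite le_max lexx.
have lnxi : ln xi < 0 by rewrite ln_lt0 // xi0.
pose F := Num.floor (Psi 0 / kap).
have F0 : (0 <= F)%R by rewrite floor_ge0 divr_ge0 // ltW.
(* If the claim fails, every index up to the bound has [eps < chi k]. Index 0 is among them, which
   yields [1 <= F]. *)
apply: contrapT => noK.
have chiN (k : nat) : (k%:Z <= (U + 1) * F)%R -> eps < chi k.
  by move=> kN; rewrite ltNge; apply/negP => chik; apply: noK; exists k.
have F1 : (1 <= F)%R.
  rewrite floor_ge_int_tmp ler_pdivlMr // mul1r; apply: chi0; apply: chiN.
  by rewrite mulr_ge0 // addr_ge0.
(* [j] successful and [w] unsuccessful iterations precede iteration [k] *)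
have inv (k : nat) : (k%:Z <= (U + 1) * F + 1)%R -> exists j w : nat,
    [/\ k = (j + w)%N, alpha k = xi ^+ w * alpha 0,
        Psi k + j%:R * kap <= Psi 0 & (w%:Z <= U)%R].
  elim: k => [|k IH] kN.
    by exists 0%N, 0%N; rewrite expr0 mul1r mul0r addr0.
  have kN' : (k%:Z <= (U + 1) * F)%R by lia.
  have [|j [w [kE aE PE wU]]] := IH; first by lia.
  have chik := chiN _ kN'.
  have [Sk|Sk] := pselect (S k).
    exists j.+1, w; split=> //; first by rewrite kE addSn.
    - by rewrite aS.
    - have := Psik _ Sk chik; rewrite -natr1; lra.
  have [aE' thrk] := aN _ Sk.
  exists j, w.+1; split; first by rewrite kE addnS.
  - by rewrite aE' aE exprS mulrA.
  - by have := Psid k; lra.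
  (* A failure at [alpha k = xi ^+ w * alpha 0] forces [thr / alpha 0 < xi ^+ w]. Dividing
     logarithms by [ln xi < 0] gives [w] strictly below the quotient, so [w + 1] is at most its
     ceiling. *)
  - rewrite le_max; apply/orP; right.
    rewrite -[w.+1]addn1 PoszD lezD1.
    rewrite ceil_gt_int ltr_ndivlMr // -pmulrn mulr_natl -lnXn //.
    by rewrite ltr_ln ?posrE ?divr_gt0 ?exprn_gt0 // ltr_pdivrMr // -aE.
have N0 : (0 <= (U + 1) * F + 1)%R by rewrite addr_ge0 // mulr_ge0 // addr_ge0.
(* One index past the bound, [(U + 1) * F + 1 = j + w <= F + U], which contradicts [U <= U * F]. *)
have [|j [w [NE _ PE wU]]] := inv (absz ((U + 1) * F + 1)); first by rewrite gez0_abs.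
have jF := floorP _ _ PE.
have : ((j + w)%N%:Z = (U + 1) * F + 1)%R by rewrite -NE gez0_abs.
have : (U <= U * F)%R by rewrite ler_peMr.
rewrite -/F in jF; rewrite PoszD mulrDl mul1r; lia.
Qed.

(* [th] is a step length along the trial step; [r z >= th * r z] and
   [r (z + (v + u)) >= 0] replace convexity of [r]. *)
Lemma objective_gap_ge {R : realType} {n : nat} (f r : 'cV[R]_n -> R)
  (g : 'cV[R]_n -> 'cV[R]_n) (X : set 'cV[R]_n) (finf Lg a sigbar Q th : R)
  (z u v : 'cV[R]_n) :
  (forall z, differentiable f z /\ forall h, 'd f z h = dotv (g z) h) ->
  (forall z, 0 <= r z) -> Defs.convex_set X -> X z -> X (z + (v + u)) ->
  (forall z1 z2, X z1 -> X z2 -> norm2 (g z1 - g z2) <= Lg * norm2 (z1 - z2)) ->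
  (forall z, X z -> finf <= f z) ->
  norm2 (v + u) ^+ 2 = norm2 v ^+ 2 + norm2 u ^+ 2 ->
  0 < a -> 2^-1 <= sigbar ->
  dotv (g z) (v + u) + r (z + (v + u)) - r z + norm2 u ^+ 2 / a
    + sigbar * norm2 v ^+ 2 / a <= Q ->
  0 <= th <= 1 -> th * Lg <= a^-1 ->
  th * (norm2 u ^+ 2 / a / 2 - Q) <= f z - finf + r z.
Proof.
move=> df r0 cX Xz Xzs lip flb orth a0 sb mod th01 thL.
have seg t : 0 <= t <= 1 -> X (z + t *: (v + u)).
  move=> t01; have := cX _ _ t Xzs Xz t01.
  by rewrite scalerDr scalerBl scale1r addrC addrA subrK.
have := descent_lemma f g z (th *: (v + u)) Lg df.
have /flb fth := seg _ th01.
have {}lip t : 0 <= t <= 1 -> norm2 (g (z + t *: (th *: (v + u))) - g z)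
    <= Lg * norm2 (t *: (th *: (v + u))).
  move=> /andP[t0 t1]; rewrite scalerA.
  have tt : 0 <= t * th <= 1.
    by case/andP: th01 => h0 h1; rewrite mulr_ge0 // mulr_ile1.
  have {2}-> : (t * th) *: (v + u) = z + (t * th) *: (v + u) - z by rewrite [RHS]addrC addKr.
  by apply: lip => //; exact: seg.
move=> /(_ lip); case/andP: th01 => th0 th1.
rewrite norm2Z ger0_norm // exprMn orth dotvZr.
have := ler_wpM2l th0 mod; have := r0 (z + (v + u)); have := r0 z.
move: (norm2 u ^+ 2) (norm2 v ^+ 2) (sqr_ge0 (norm2 u)) (sqr_ge0 (norm2 v)).
move=> u2 v2 u20 v20 rz rzs mod' fle.
(* The curvature term is at most [th * (v2 + u2) / (2 * a)]. The [v2] part is absorbed because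
   [sigbar >= 1/2], and half of [u2 / a] survives. *)
have h1 := ler_wpM2l th0 (ler_wpM2r (addr_ge0 u20 v20) thL).
have av : 0 <= v2 / a by rewrite divr_ge0 // ltW.
have h2 := ler_wpM2l th0 (ler_wpM2r av sb).
have h3 := ler_wpM2r rz th1.
have h4 := mulr_ge0 th0 rzs.
lra.
Qed.

(** * Application of the estimates to a run of the algorithm *)

Theorem theorem3p16 (R : realType) (n m : nat)
  (f r : 'cV[R]_n -> R) (g : 'cV[R]_n -> 'cV[R]_n)
  (c : 'cV[R]_n -> 'cV[R]_m) (J : 'cV[R]_n -> 'M[R]_(m, n))
  (kv sigc epst xi eta sigu taum1 : R)
  (x v u gr : nat -> 'cV[R]_n) (y : nat -> 'cV[R]_m) (alpha tau : nat -> R)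
  (X : set 'cV[R]_n)
  (finf kgf kc kgc kdr Lg LJ sigmin : R) :
  (m <= n)%N ->
  (* f, c continuously differentiable, g = grad f, J = Jacobian of c *)
  (forall z, differentiable f z /\ forall h, 'd f z h = dotv (g z) h) ->
  continuous g ->
  (forall z, differentiable c z /\ forall h, 'd c z h = J z *m h) ->
  continuous J ->
  (* r convex, nonnegative *)
  convex_fun r -> (forall z, 0 <= r z) ->
  (* algorithm constants *)
  0 < alpha 0 -> 0 < taum1 -> 0 < kv ->
  0 < sigc < 1 -> 0 < epst < 1 -> 0 < xi < 1 -> 0 < eta < 1 ->
  0 < sigu <= 2^-1 ->
  (* the iterates are generated by the algorithm ... *)
  algorithm_run f r g c J kv sigc epst xi eta sigu taum1 x v u gr y alpha tau ->
  (* ... which does not terminate finitely *)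
  (forall k, ((J (x k))^T *m c (x k) = 0 -> c (x k) = 0) /\ v k + u k != 0) ->
  (* standing assumption *)
  open X -> convex_set X ->
  (forall k, X (x k) /\ X (x k + (v k + u k))) ->
  0 < kgf -> 0 < kc -> 0 < kgc -> 0 < kdr -> 0 < Lg -> 0 < LJ ->
  (forall z, X z ->
     finf <= f z /\ norm2 (g z) <= kgf /\ norm2 (c z) <= kc
     /\ opnorm (J z) <= kgc /\ (forall w, subgrad r z w -> norm2 w <= kdr)) ->
  (forall z1 z2, X z1 -> X z2 ->
     norm2 (g z1 - g z2) <= Lg * norm2 (z1 - z2)
     /\ opnorm (J z1 - J z2) <= LJ * norm2 (z1 - z2)) ->
  (* uniform lower bound on the smallest singular value of J_k *)
  0 < sigmin -> (forall k, sigmin <= sigma_min (J (x k))) ->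
  let sigbar := sigu + 2^-1 in
  let K := 2 * kv * kgc * (kgf + kdr + sigbar * kc * kv * kgc) in
  let tau_min_trial := Num.min ((1 - sigc) * kv * sigmin ^+ 2 / K)
                              ((1 - sigc) * (sigmin / kgc) ^+ 2 / (K * alpha 0)) in
  let tau_min := Num.min (tau 0) ((1 - epst) * tau_min_trial) in
  let alpha_min := Num.min (alpha 0) (xi * tau_min / (tau_min * Lg + LJ)) in
  let kPhi := eta * Num.min (sigu * tau_min * alpha_min)
                (Num.min (sigc * sigmin ^+ 2 / (2 * kc * (1 + kgc ^+ 2)))
                         (sigc * sigmin ^+ 2 * kv * alpha_min / (2 * kc))) in
  let B := tau 0 * (f (x 0) - finf + r (x 0)) + norm2 (c (x 0)) in
  (forall (eps : R) (k1 k2 : nat), 0 < eps -> (k1 < k2)%N ->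
     (forall k, (k1 <= k < k2)%N ->
        successful f r g c J eta x v u alpha tau k /\ eps < chi g c J x gr y k) ->
     (((k2 - k1)%N)%:Z <= Num.floor (B / (kPhi * eps ^+ 2)))%R)
  /\
  (forall eps : R, 0 < eps ->
     exists k : nat,
       (k%:Z <= (Num.max 0 (Num.ceil (ln (tau_min / (alpha 0 * (tau_min * Lg + LJ)))
                                       / ln xi)) + 1)
                * Num.floor (B / (kPhi * eps ^+ 2)))%R
       /\ chi g c J x gr y k <= eps).
Proof.
move=> _ df _ dc _ _ r0 a0 tm0 kv0 /andP[sc0 sc1] ep01 /andP[xi0 xi1].
move=> /andP[eta0 eta1] /andP[su0 su1] run nt _ /convex_setP cX XX.
move=> kgf0 kc0 kgc0 kdr0 Lg0 LJ0 bnd lip sig0 sJ sigbar K tmt tmin amin kPhi B.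
have sb0 : 0 < sigbar by rewrite addr_gt0 ?invr_gt0.
have sb1 : sigbar <= 1 by rewrite /sigbar; lra.
have K0 : 0 < K by rewrite !mulr_gt0 ?addr_gt0 ?mulr_gt0.
have tmt0 : 0 < tmt.
  have sc : 0 < 1 - sigc by rewrite subr_gt0.
  rewrite /tmt; move: (K) K0 => K' K'0.
  by rewrite lt_min !(divr_gt0, mulr_gt0, exprn_gt0).
pose S := successful f r g c J eta x v u alpha tau.
pose s k := v k + u k.
pose red k := norm2 (c (x k)) - norm2 (c (x k) + J (x k) *m v k).
have stepS k : S k -> x k.+1 = x k + s k /\ alpha k.+1 = alpha k.
  by have [_ [_ [_ [_ [_ [_ [_ [h _]]]]]]]] := run k.
have stepN k : ~ S k -> x k.+1 = x k /\ alpha k.+1 = xi * alpha k.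
  by have [_ [_ [_ [_ [_ [_ [_ [_ h]]]]]]]] := run k.
have alpha_bd k : 0 < alpha k <= alpha 0.
  elim: k => [|k /andP[IH0 IH1]]; first by rewrite a0 lexx.
  have [/stepS[_ ->]|/stepN[_ ->]] := pselect (S k); first by rewrite IH0.
  by rewrite mulr_gt0 //=; apply: le_trans IH1; rewrite ler_piMl ?(ltW xi1) ?(ltW IH0).
have ak0 k : 0 < alpha k by case/andP: (alpha_bd k).
have Ju k : J (x k) *m u k = 0 by have [_ [_ [-> _]]] := run k.
have bndx k := bnd _ (XX k).1.
have vP k : (exists w, v k = (J (x k))^T *m w)
    /\ norm2 (v k) <= kv * alpha k * norm2 ((J (x k))^T *m c (x k)).
  have [h1 [h2 _]] := run k.
  have [d0|dn0] := eqVneq ((J (x k))^T *m c (x k)) 0; last first.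
    by have [hw [hv _]] := h1 dn0.
  rewrite h2 // d0 !norm20 mulr0; split=> //.
  by exists 0; rewrite mulmx0.
have redP k : 2^-1 * Num.min (kv * alpha k) (kgc ^- 2) * sigmin ^+ 2 * norm2 (c (x k))
    <= red k.
  have [h1 [h2 _]] := run k.
  have [_ [_ [_ [Jk _]]]] := bndx k.
  apply: cauchy_decrease => //; first by rewrite mulr_gt0.
  move=> dn0; have [_ [_ [beta [_ [b1 b2]]]]] := h1 dn0.
  by exists beta.
have red0 k : 0 <= red k.
  apply: le_trans (redP k); rewrite !mulr_ge0 ?norm2_ge0 ?invr_ge0 ?(ltW sig0) //.
  by rewrite le_min invr_ge0 sqr_ge0 mulr_ge0 // ltW.
have orth k : norm2 (s k) ^+ 2 = norm2 (v k) ^+ 2 + norm2 (u k) ^+ 2.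
  exact: norm2_sqrD_orth (Ju k) (vP k).1.
have model k : dotv (g (x k)) (s k) + r (x k + s k) - r (x k)
     + norm2 (u k) ^+ 2 / alpha k + sigbar * norm2 (v k) ^+ 2 / alpha k
   <= K / 2 * alpha k * norm2 (c (x k)).
  have [_ [_ [_ [_ [sub [opt _]]]]]] := run k.
  have [_ [gk [ck [Jk _]]]] := bndx k.
  have [_ [_ [_ [_ rk]]]] := bnd _ (XX k).2.
  have -> : K / 2 = kv * kgc * (kgf + kdr + sigbar * kc * kv * kgc).
    by rewrite /K; field.
  apply: (model_decrease _ (J (x k)) _ _ _ _ (gr k) (y k) _ _ _ _ _ kc) => //.
  - exact: ltW.
  - exact: (vP k).1.
  - exact: (vP k).2.
  - exact: rk.
have tmtP k : tmt * (K / 2 * alpha k * norm2 (c (x k))) <= (1 - sigc) * red k.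
  have := tau_min_trial_le sigc kv sigmin K kgc (alpha k) (alpha 0) sc1 kv0 K0 kgc0
    (alpha_bd k).
  rewrite -/tmt => h.
  have := ler_wpM2r (norm2_ge0 (c (x k))) h.
  have := ler_wpM2l (_ : 0 <= 1 - sigc) (redP k); rewrite subr_ge0 ltW // => /(_ isT).
  lra.
pose D k := dotv (g (x k)) (s k) + sigbar * norm2 (s k) ^+ 2 / alpha k
            + r (x k + s k) - r (x k).
(* [D k] carries [sigbar] in front of [norm2 (u k) ^+ 2 / alpha k] where [model] has 1, so
   [sigbar <= 1], that is [sigu <= 1/2], suffices. *)
have DP k : D k <= K / 2 * alpha k * norm2 (c (x k)).
  apply: le_trans (model k); rewrite /D orth.
  have : 0 <= norm2 (u k) ^+ 2 / alpha k by rewrite divr_ge0 ?sqr_ge0 // ltW.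
  have := sb1; rewrite -subr_ge0 => h1 /(mulr_ge0 h1); lra.
have tau_step k : 0 < tau_prev taum1 tau k ->
    [/\ 0 < tau k, tau k <= tau_prev taum1 tau k,
        tau k * D k <= (1 - sigc) * red k &
        Num.min (tau_prev taum1 tau k) ((1 - epst) * tmt) <= tau k].
  move=> tp0; have [_ [_ [_ [_ [_ [_ [tauE _]]]]]]] := run k.
  apply: (tau_update_bounds _ _ _ epst sigc tmt _ tp0 ep01 sc1 (red0 k) tmt0 _ tauE).
  by move=> _; apply: le_trans (tmtP k); rewrite ler_pM2l //; exact: DP.
have tau0 k : 0 < tau k.
  by elim: k => [|k IH]; [have [] := tau_step 0%N tm0|have [] := tau_step k.+1 IH].
have tauS k : tau k.+1 <= tau k by have [] := tau_step k.+1 (tau0 k).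
have tauD k : tau k * D k <= (1 - sigc) * red k.
  by case: k => [|k]; [have [] := tau_step 0%N tm0|have [] := tau_step k.+1 (tau0 k)].
have tmin0 : 0 < tmin.
  by rewrite lt_min tau0 mulr_gt0 // subr_gt0; case/andP: ep01.
have tminP k : tmin <= tau k.
  elim: k => [|k IH]; first by rewrite ge_min lexx.
  have [_ _ _] := tau_step k.+1 (tau0 k); apply: le_trans.
  by rewrite le_min IH ge_min lexx orbT.
pose dq k := Dq f r g c J (x k) (alpha k) (s k) (tau k).
(* [Dq] contains 1/2 where [D] contains [sigbar], and the difference is [sigu]. Since [u k] is in
   the kernel of [J (x k)], the constraint part of [Dq] is exactly [red k]. *)
have dqP k : tau k * sigu * (norm2 (s k) ^+ 2 / alpha k) + sigc * red k <= dq k.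
  rewrite /dq /Dq mulmxDr Ju addr0.
  have := tauD k; rewrite /D /sigbar /red invfM; lra.
have dq0 k : 0 <= dq k.
  apply: le_trans (dqP k); rewrite addr_ge0 ?(mulr_ge0 (ltW sc0)) //.
  by rewrite !mulr_ge0 ?norm2_ge0 ?invr_ge0 // ltW.
pose thr := tmin / (tmin * Lg + LJ).
have den0 : 0 < tmin * Lg + LJ by rewrite addr_gt0 // mulr_gt0.
have thr0 : 0 < thr by rewrite divr_gt0.
have thrP k : ~ S k -> thr < alpha k.
  move=> Sk; rewrite ltNge; apply/negP => ath; apply: Sk.
  have h := merit_descent f r g c J X Lg LJ (alpha k) (tau k) (x k) (s k) df dc cX
    (XX k).1 (XX k).2 (ltW LJ0) lip (ak0 k) (ltW (tau0 k)).
  apply: le_trans h _.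
  have h1 : (tau k * Lg + LJ) - tau k / alpha k <= 0.
    rewrite subr_le0 ler_pdivlMr //.
    rewrite ler_pdivlMr // in ath.
    (* The threshold is stated with [tmin] but needed with [tau k]. It reads [alpha k * LJ <= tmin *
       (1 - alpha k * Lg)], and nonnegativity of the last factor allows [tmin] to be raised to
       [tau k]. *)
    have aL : 0 <= 1 - alpha k * Lg.
      rewrite -(pmulr_rge0 _ tmin0).
      have := mulr_gt0 (ak0 k) LJ0; lra.
    have := ler_wpM2r aL (tminP k); lra.
  have h2 : (tau k * Lg + LJ - tau k / alpha k) * norm2 (s k) ^+ 2 / 2 <= 0.
    by rewrite -mulrA mulr_le0_ge0 // divr_ge0 // sqr_ge0.
  have h3 : eta * dq k <= dq k by rewrite ler_piMl // ltW.
  rewrite -/(dq k) -/(s k); lra.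
have amin0 : 0 < amin by rewrite lt_min a0 divr_gt0 // mulr_gt0.
have aminP k : amin <= alpha k.
  elim: k => [|k IH]; first by rewrite ge_min lexx.
  have [/stepS[_ ->//]|Sk] := pselect (S k).
  have [_ ->] := stepN k Sk.
  (* A failure happens only above [thr], so one contraction by [xi] stays above [xi * thr]. *)
  by rewrite ge_min -mulrA ler_wpM2l ?orbT // ltW // thrP.
pose w k := norm2 (u k) / alpha k.
have w0 k : 0 <= w k by rewrite divr_ge0 ?norm2_ge0 // ltW.
have chiE k : chi g c J x gr y k = Num.max (w k) (norm2 (c (x k))).
  rewrite /chi; congr (Num.max _ _).
  have [_ [_ [_ [_ [_ [opt _]]]]]] := run k.
  have -> : g (x k) + gr k - (J (x k))^T *m y k = - ((alpha k)^-1 *: u k).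
    apply/eqP; rewrite -subr_eq0 opprK -opt; apply/eqP.
    by rewrite addrAC (addrAC _ (gr k)).
  by rewrite norm2N norm2Z gtr0_norm ?invr_gt0 // mulrC.
have aw k : alpha k * w k ^+ 2 = norm2 (u k) ^+ 2 / alpha k.
  by rewrite /w; field; rewrite gt_eqF.
pose Psi k := tau k * (f (x k) - finf + r (x k)) + norm2 (c (x k)).
have gap0 k : 0 <= f (x k) - finf + r (x k).
  by rewrite addr_ge0 // subr_ge0; case: (bndx k).
have Psi0 k : 0 <= Psi k by rewrite addr_ge0 ?norm2_ge0 // mulr_ge0 // ltW.
(* Subtracting [finf] makes the factor of [tau] nonnegative, so lowering the merit parameter cannot
   raise the potential. *)
have PsiP k : Psi k.+1 <= Phi f r c (tau k) (x k.+1) - tau k * finf.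
  by have := ler_wpM2r (gap0 k.+1) (tauS k); rewrite /Psi /Phi; lra.
have PsiE k : Psi k = Phi f r c (tau k) (x k) - tau k * finf.
  by rewrite /Psi /Phi; lra.
have PsiS k : S k -> Psi k.+1 + eta * dq k <= Psi k.
  move=> Sk; have := PsiP k; have [-> _] := stepS k Sk.
  rewrite (PsiE k); move: Sk; rewrite /S /successful -/(s k) -/(dq k); lra.
have Psid k : Psi k.+1 <= Psi k.
  have [/PsiS h|Sk] := pselect (S k).
    by apply: le_trans h; rewrite lerDl mulr_ge0 // ltW.
  by apply: le_trans (PsiP k) _; have [-> _] := stepN k Sk; rewrite PsiE.
pose k' := Num.min (sigu * tmin * amin)
    (Num.min (sigc * sigmin ^+ 2 / (2 * kc * (1 + kgc ^+ 2)))
             (sigc * sigmin ^+ 2 * kv * amin / (2 * kc))).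
have k'0 : 0 < k'.
  by rewrite !lt_min !(divr_gt0, mulr_gt0, addr_gt0, exprn_gt0).
have dqk eps k : 0 < eps -> eps < chi g c J x gr y k -> k' * eps ^+ 2 <= dq k.
  rewrite chiE => e0 ek; apply: le_trans (dqP k).
  have [_ [_ [ck _]]] := bndx k.
  apply: le_trans (kPhi_le sigu sigc tmin amin sigmin kc kgc kv (tau k) (alpha k)
    (w k) _ (red k) eps su0 sc0 tmin0 amin0 kc0 kgc0 kv0 (tminP k) (aminP k) (w0 k) _ e0
    (redP k) ek) _; first by rewrite norm2_ge0.
  rewrite lerD2r aw ler_wpM2l //; first by rewrite mulr_ge0 // ltW.
  rewrite ler_wpM2r ?invr_ge0 ?(ltW (ak0 k)) //.
  by rewrite orth lerDr sqr_ge0.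
have red_le k : red k <= norm2 (c (x k)) by rewrite gerBl norm2_ge0.
(* Iteration 0 may be unsuccessful, so this bound cannot come from a merit decrease. *)
have first_merit eps : 0 < eps -> eps < chi g c J x gr y 0 ->
    kPhi * eps ^+ 2 <= Psi 0%N.
  move=> e0; rewrite chiE => ch.
  have kPhiE : kPhi = eta * k' by [].
  have [_ [_ [c0le [Jk _]]]] := bndx 0%N.
  have c00 := norm2_ge0 (c (x 0%N)).
  have Psi0min : tmin * (f (x 0%N) - finf + r (x 0%N)) + norm2 (c (x 0%N)) <= Psi 0%N.
    by rewrite lerD2r ler_wpM2r.
  have k'e : kPhi * eps ^+ 2 <= k' * eps ^+ 2.
    by rewrite kPhiE ler_wpM2r ?sqr_ge0 // ler_piMl ?(ltW k'0) ?(ltW eta1).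
  apply: le_trans k'e _; apply: le_trans Psi0min.
  move: ch; rewrite lt_max => /orP[ew|ec].
    (* The largest fraction of the trial step, at most 1, with [th * Lg <= 1 / alpha 0]. Then
       [alpha 0 * th] is the minimum of [alpha 0] and [1 / Lg], which dominates [amin]. *)
    pose th := Num.min 1 ((alpha 0%N * Lg)^-1).
    have aLg0 : 0 < alpha 0%N * Lg by rewrite mulr_gt0.
    have th0 : 0 < th by rewrite lt_min ltr01 invr_gt0.
    have th01 : 0 <= th <= 1 by rewrite (ltW th0) ge_min lexx.
    have thL : th * Lg <= (alpha 0%N)^-1.
      apply: (@le_trans _ _ ((alpha 0%N * Lg)^-1 * Lg)).
        by rewrite ler_wpM2r ?(ltW Lg0) // ge_min lexx orbT.
      by rewrite invfM mulfVK ?gt_eqF.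
    have sbh : 2^-1 <= sigbar by rewrite lerDr ltW.
    have gap := objective_gap_ge f r g X finf Lg (alpha 0%N) sigbar _ th (x 0%N)
      (u 0%N) (v 0%N) df r0 cX (XX 0%N).1 (XX 0%N).2
      (fun z1 z2 h1 h2 => (lip z1 z2 h1 h2).1) (fun z h => (bnd z h).1)
      (orth 0%N) a0 sbh (model 0%N) th01 thL.
    have ath : amin <= alpha 0%N * th.
      rewrite /th minr_pMr ?(ltW a0) // mulr1 invfM mulVKf ?gt_eqF //.
      rewrite le_min ge_min lexx /= ge_min; apply/orP; right.
      rewrite ler_pdivrMr // ler_pdivlMl //.
      have := ler_wpM2r (mulr_ge0 (ltW Lg0) (ltW tmin0)) (ltW xi1); lra.
    (* The error term of [gap], scaled by [tmin], is paid for by the constraint violation in the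
       potential. *)
    have tQ : tmin * (K / 2 * alpha 0%N * norm2 (c (x 0%N))) <= norm2 (c (x 0%N)).
      apply: (@le_trans _ _ (tmt * (K / 2 * alpha 0%N * norm2 (c (x 0%N))))).
        rewrite ler_wpM2r //.
          exact: mulr_ge0 (mulr_ge0 (divr_ge0 (ltW K0) (ler0n _ 2)) (ltW a0)) c00.
        rewrite ge_min; apply/orP; right.
        by case/andP: ep01 => ep0 _; rewrite ler_piMl ?(ltW tmt0) // gerBl ltW.
      apply: le_trans (tmtP _) _; apply: le_trans (red_le 0%N).
      by rewrite ler_piMl // gerBl ltW.
    have e2 : eps ^+ 2 <= w 0%N ^+ 2 by rewrite ler_sqr ?nnegrE // ltW.
    have kle : k' <= 2^-1 * (tmin * amin).
      apply: (@le_trans _ _ (sigu * tmin * amin)); first by rewrite ge_min lexx.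
      by rewrite -mulrA ler_wpM2r // mulr_ge0 // ltW.
    have h1 := ler_wpM2l (ltW tmin0) gap.
    have h2 : th * norm2 (c (x 0%N)) <= norm2 (c (x 0%N)).
      by case/andP: th01 => _ h; rewrite ler_piMl.
    have h3 := ler_wpM2l (ltW th0) tQ.
    have h4 : k' * eps ^+ 2 <= 2^-1 * (tmin * (alpha 0%N * th)) * w 0%N ^+ 2.
      apply: ler_pM => //; [exact: ltW|exact: sqr_ge0|].
      by apply: le_trans kle _; rewrite !ler_wpM2l ?invr_ge0 ?(ltW tmin0).
    rewrite -aw in h1; lra.
  have e2 : eps ^+ 2 <= norm2 (c (x 0%N)) ^+ 2 by rewrite ler_sqr ?nnegrE // ltW.
  have cp : 0 < norm2 (c (x 0%N)) := lt_trans e0 ec.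
  (* The nonzero vector [c (x 0)] compares the two bounds on the transposed Jacobian. Together with
     [sigc < 1] this reduces the second entry of [k'] to [1 / (2 * kc)], and half of
     [norm2 (c (x 0))] then covers [k' * eps ^+ 2]. *)
  have sk : sigmin <= kgc.
    rewrite -(ler_pM2r cp); apply: le_trans (sigma_min_le_norm2 _ _ _ (sJ 0%N)) _.
    by apply: norm2_trmx_mulmx_le; rewrite // ltW.
  have kle : k' <= (2 * kc)^-1.
    apply: (@le_trans _ _ (sigc * sigmin ^+ 2 / (2 * kc * (1 + kgc ^+ 2)))).
      by rewrite !ge_min lexx !orbT.
    rewrite invfM mulrCA ler_piMr ?invr_ge0 ?mulr_ge0 ?(ltW kc0) //.
    rewrite ler_pdivrMr ?addr_gt0 ?exprn_gt0 // mul1r.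
    apply: (@le_trans _ _ (sigmin ^+ 2)); first by rewrite ler_piMl ?sqr_ge0 ?(ltW sc1).
    have : sigmin ^+ 2 <= kgc ^+ 2 by rewrite ler_sqr ?nnegrE // ltW.
    by move=> /le_trans; apply; rewrite lerDr.
  apply: (@le_trans _ _ ((2 * kc)^-1 * norm2 (c (x 0%N)) ^+ 2)).
    by apply: ler_pM; rewrite ?sqr_ge0 ?(ltW k'0).
  have := mulr_ge0 (ltW tmin0) (gap0 0%N).
  have : norm2 (c (x 0%N)) ^+ 2 / kc <= norm2 (c (x 0%N)).
    by rewrite ler_pdivrMr // expr2 ler_wpM2l.
  rewrite invfM; lra.
have thrE : tmin / (alpha 0 * (tmin * Lg + LJ)) = thr / alpha 0.
  by rewrite /thr invfM mulrAC mulrA.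
have xi01 : 0 < xi < 1 by rewrite xi0.
have kap0 eps : 0 < eps -> 0 < kPhi * eps ^+ 2.
  by move=> e0; rewrite mulr_gt0 ?exprn_gt0 // mulr_gt0.
have PsiK eps : 0 < eps -> forall k, S k -> eps < chi g c J x gr y k ->
    Psi k.+1 + kPhi * eps ^+ 2 <= Psi k.
  move=> e0 k Sk ek; apply: le_trans (PsiS k Sk); rewrite lerD2l.
  by rewrite -mulrA ler_pM2l //; exact: dqk.
have aS k : S k -> alpha k.+1 = alpha k by move=> /stepS[].
have aN k : ~ S k -> alpha k.+1 = xi * alpha k /\ thr < alpha k.
  by move=> Sk; split; [case: (stepN k Sk)|exact: thrP].
have count eps (e0 : 0 < eps) := iteration_count Psi alpha (chi g c J x gr y) S
  xi thr (kPhi * eps ^+ 2) eps xi01 thr0 (kap0 eps e0) a0 Psi0 Psid (PsiK eps e0)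
  aS aN (first_merit eps e0).
split=> [eps k1 k2 e0 k12 Sk|eps e0].
  exact: (count eps e0).1.
by rewrite thrE; exact: (count eps e0).2.
Qed.
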